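(* Let $V$ be a countable (finite or countably infinite) set. For every $n\in\mathbb{N}$ there exists a natural number $k_1=k_1(n)$ such that for every colouring $\Delta:V^{(2)}\rightarrow\mathbb{N}$ that uses at least $k_1$ distinct colours, at least one of the following holds: (i) for every $m\in\{1,\dots,n\}$ there is $X\subset V$ with $|\Delta(X^{(2)})|=m$; (ii) there is a rainbow coloured set $X\subset V$ with $|X|=n$; (iii) there is a star coloured set $X\subset V$ with $|X|=n$.
   Context: $V^{(2)}$ is the set of unordered pairs of elements of $V$ (edges of the complete graph on $V$); $\Delta(X^{(2)})$ is the set of colours on edges within $X$. $X$ is rainbow coloured if no two distinct edges within $X$ get the same colour. $X$ is star coloured (with centre $v$) if there is $v\in X$ such that all edges within $X\setminus\{v\}$ have the same colour and the edges between $v$ and $X\setminus\{v\}$ have pairwise distinct colours, all different from that colour. *)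

(* Defs.v *)
From mathcomp Require Import all_boot.
From mathcomp Require Import boolp classical_sets functions cardinality.

Set Implicit Arguments.
Unset Strict Implicit.
Unset Printing Implicit Defensive.

Local Open Scope classical_set_scope.
Local Open Scope card_scope.

(* V^(2): an unordered pair is a two-element subset of V. *)
Definition edge (V : Type) := {e : set V | e #= `I_2}.

(* X^(2), as a set of elements of V^(2). *)
Definition edges_within (V : Type) (X : set V) : set (edge V) :=
  [set e | sval e `<=` X].

Definition colours (V : Type) (D : edge V -> nat) (X : set V) : set nat :=
  D @` edges_within X.

Definition rainbow (V : Type) (D : edge V -> nat) (X : set V) : Prop :=
  forall e f : edge V, edges_within X e -> edges_within X f ->
    e <> f -> D e <> D f.

(* The edges between v and X \ {v} are the edges within X that contain v. *)
Definition star_centred (V : Type) (D : edge V -> nat) (X : set V) (v : V)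
    : Prop :=
  exists c : nat,
  [/\ forall e : edge V, edges_within (X `\ v) e -> D e = c,
      forall e f : edge V, edges_within X e -> edges_within X f ->
        sval e v -> sval f v -> e <> f -> D e <> D f
    & forall e : edge V, edges_within X e -> sval e v -> D e <> c].

Definition star (V : Type) (D : edge V -> nat) (X : set V) : Prop :=
  exists2 v : V, X v & star_centred D X v.

(* Main.v *)
Require Import Defs.
From mathcomp Require Import all_boot zify.
From mathcomp Require Import boolp classical_sets functions cardinality.

(* Choose one edge of each of many colours.  These edges contain a large star
   or a large matching.

   Star at w with leaves v_i: by the Erdos-Rado canonical Ramsey theorem we may
   assume that the colour of v_i v_j (i < j) is constant (a star coloured set),
   an injective function of i or of j (adding the leaves one at a time then
   realises every number of colours), or an injective function of (i, j)
   (a rainbow set).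

   Matching v_i w_i: apply the canonical theorem to v_i v_j, w_i w_j, v_i w_j
   and w_i v_j for i < j.  If one of these colourings is not constant, some
   vertex sees many colours and the star case applies.  If all four are
   constant, a suitable ordering of the vertices adds at most one colour at
   each step, hence realises every number of colours. *)

Set Implicit Arguments.
Unset Strict Implicit.
Unset Printing Implicit Defensive.

(** * Ramsey's theorem for subsequences of fixed length *)

Lemma pigeonhole_count (T : eqType) (C : finType) (f : T -> C) (s : seq T) N :
  N * #|C| < size s -> exists c, N <= count [pred x | f x == c] s.
Proof.
move=> lts; case: (boolP [exists c, N <= count [pred x | f x == c] s]).
  by move/existsP.
rewrite negb_exists => /forallP small; exfalso.
suff : size s <= N * #|C| by rewrite leqNgt lts.
have -> : size s = \sum_(c : C) count [pred x | f x == c] s.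
  elim: s {lts small} => [|x s IH] /=; first by rewrite big1.
  rewrite big_split /= -IH (bigD1 (f x)) //= eqxx big1 ?addn0 ?add1n // => c.
  by rewrite eq_sym => /negPf->.
rewrite mulnC -sum_nat_const; apply: leq_sum => c _.
by apply: ltnW; rewrite ltnNge small.
Qed.

(* [prehom] makes the colour of an (r+1)-subsequence depend on
   its first element only, and pigeonhole then fixes that colour. *)
Lemma ramsey (C : finType) (r N : nat) : exists M, forall (T : eqType)
    (f : seq T -> C) (s : seq T), uniq s -> M <= size s ->
  exists t c, [/\ subseq t s, size t = N &
    forall u, subseq u t -> size u = r -> f u = c].
Proof.
elim: r N => [|r IHr] N.
  exists N => T f s _ leN; exists (take N s), (f [::]).
  split=> [||u _ /size0nil->//]; first exact: take_subseq.
  by rewrite size_takel.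
have prehom L : exists M, forall (T : eqType) (f : seq T -> C) (s : seq T),
    uniq s -> M <= size s ->
    exists t (col : T -> C), [/\ subseq t s, size t = L &
      forall x u, subseq (x :: u) t -> size u = r -> f (x :: u) = col x].
  elim: L => [|L [M0 IHL]].
    exists 1 => T f [//|x s] _ _.
    by exists [::], (fun=> f [::]); split.
  have [M1 HM1] := IHr M0.
  (* One element is spent on [x]. The others are numerous enough for the colouring [f (x :: u)] of
     [r]-subsequences [u] to be constant on [M0] of them. *)
  exists M1.+1 => T f [//|x s] /= /andP[xs us] les.
  have [t0 [c [sub0 sz0 mono0]]] := HM1 T (fun u => f (x :: u)) s us les.
  have [t [col [subt szt monot]]] : exists t (col : T -> C),
     [/\ subseq t t0, size t = L &
      forall y u, subseq (y :: u) t -> size u = r -> f (y :: u) = col y].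
    by apply: IHL; rewrite ?sz0 // (subseq_uniq sub0).
  have subts := subseq_trans subt sub0.
  exists (x :: t), (fun y => if y == x then c else col y).
  split=> [||y u] /=; rewrite ?eqxx ?szt //.
  case: eqP => [->|_] su su_r; first exact: mono0 (subseq_trans su subt) su_r.
  exact: monot.
have [M HM] := prehom (N * #|C|).+1.
exists M => T f s us les.
have [t [col [subt szt colP]]] := HM T f s us les.
have [|c le_c] := @pigeonhole_count _ _ col t N; first by rewrite szt.
have sub2 : subseq (take N (filter [pred x | col x == c] t))
                   (filter [pred x | col x == c] t) by exact: take_subseq.
exists (take N (filter [pred x | col x == c] t)), c; split.
- exact: subseq_trans sub2 (subseq_trans (filter_subseq _ _) subt).
- by rewrite size_takel // size_filter.
case=> // x u su [szu].
have su' := subseq_trans su sub2.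
rewrite (colP x u (subseq_trans su' (filter_subseq _ _)) szu).
have : x \in filter [pred x | col x == c] t by apply: (mem_subseq su'); rewrite mem_head.
by rewrite mem_filter => /andP[/eqP].
Qed.

(** * The Erdos-Rado canonical theorem for pairs of indices *)

Lemma sorted_subseq_iota (u : seq nat) N :
  sorted ltn u -> all (gtn N) u -> subseq u (iota 0 N).
Proof.
move=> su /allP ltu.
suff -> : u = filter (mem u) (iota 0 N) by exact: filter_subseq.
apply: (irr_sorted_eq ltn_trans ltnn) => //.
  by apply: (sorted_filter ltn_trans); exact: iota_ltn_sorted.
move=> i; rewrite mem_filter mem_iota /= add0n; case iu: (i \in u) => //=.
by rewrite -[i < N]/(gtn N i) ltu.
Qed.

(** A choice of [N] indices out of [M], coded as a total function so that successive choices compose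
    with [\o]. Values from [N] on are unconstrained. *)
Definition extraction (M N : nat) (g : nat -> nat) :=
  (forall i j, i < j < N -> g i < g j) /\ (forall i, i < N -> g i < M).

Lemma extraction_inj M N g i j :
  extraction M N g -> i < N -> j < N -> g i = g j -> i = j.
Proof.
move=> [g1 _] iN jN e; have := g1 i j; have := g1 j i; rewrite e ltnn iN jN !andbT.
by case: (ltngtP i j) => // _ A B; [have := B isT | have := A isT].
Qed.

(** Exponent four is what the canonical theorem asks for: comparing the colours of two pairs
    involves at most four indices. *)
Lemma ramsey4 (C : finType) N : exists M,
  forall f : nat -> nat -> nat -> nat -> C, exists g c, extraction M N g /\
  forall i j k l, [&& i < j, j < k, k < l & l < N] ->
    f (g i) (g j) (g k) (g l) = c.
Proof.
have [M HM] := ramsey C 4 N; exists M => f.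
have [t [c [subt szt tP]]] := HM nat
  (fun u => f (nth 0 u 0) (nth 0 u 1) (nth 0 u 2) (nth 0 u 3))
  (iota 0 M) (iota_uniq _ _) (eq_leq (esym (size_iota _ _))).
have st : sorted ltn t.
  exact: (subseq_sorted ltn_trans subt (iota_ltn_sorted _ _)).
exists (nth 0 t), c; split; first split.
- move=> i j /andP[ij jN].
  by rewrite (sorted_ltn_nth ltn_trans) // inE szt // (ltn_trans ij).
- move=> i iN; have : nth 0 t i \in iota 0 M.
    by apply: (mem_subseq subt); rewrite mem_nth ?szt.
  by rewrite mem_iota.
move=> i j k l /and4P[ij jk kl lN].
apply: (tP [:: nth 0 t i; nth 0 t j; nth 0 t k; nth 0 t l]) => //.
rewrite -[X in subseq _ X](mkseq_nth 0) szt.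
apply: (@map_subseq _ _ (nth 0 t) [:: i; j; k; l]).
by apply: sorted_subseq_iota => /=; lia.
Qed.

Definition canonical (N : nat) (H : nat -> nat -> nat) :=
  [\/ exists c, forall i j, i < j < N -> H i j = c,
      exists f : nat -> nat, {in gtn N &, injective f} /\
        forall i j, i < j < N -> H i j = f i,
      exists f : nat -> nat, {in gtn N &, injective f} /\
        forall i j, i < j < N -> H i j = f j
    | forall i j k l, i < j < N -> k < l < N ->
        H i j = H k l -> i = k /\ j = l].

(** Ramsey's theorem makes the pattern of equalities among the pairs of a quadruple uniform. Whether
    pairs with a common smaller index agree ([A]) and whether pairs with a common larger index agree
    ([B]) then decides between the four cases. *)
Lemma erdos_rado N : exists M, forall h : nat -> nat -> nat,
  exists g, extraction M N g /\ canonical N (fun i j => h (g i) (g j)).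
Proof.
have [M HM] := ramsey4 (bool * bool * bool * bool * bool * bool)%type (N + 3).
exists M => h.
(* [A], [B], [C] compare two pairs sharing their smaller index, their larger index, or the middle
   index; [E], [F], [G] compare disjoint pairs that are separated, crossing or nested. *)
have [g [[[[[[A B] C] E] F] G] [gM gP]]] := HM (fun i j k l =>
  (h i j == h i k, h i k == h j k, h i j == h j k,
   h i j == h k l, h i k == h j l, h i l == h j k)).
pose H i j := h (g i) (g j).
have {gP} HP i j k l : [&& i < j, j < k, k < l & l < N + 3] ->
  [/\ [/\ (H i j == H i k) = A, (H i k == H j k) = B & (H i j == H j k) = C],
   (H i j == H k l) = E, (H i k == H j l) = F & (H i l == H j k) = G].
  by move=> lt; have := gP i j k l lt => -[].
(* For the relations on triples, the top index [N + 2] serves as the fourth index. *)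
have HA i j k : i < j -> j < k -> k < N + 2 -> (H i j == H i k) = A.
  by move=> ij jk kN; have [|[]] := HP i j k (N + 2); first lia.
have HB i j k : i < j -> j < k -> k < N + 2 -> (H i k == H j k) = B.
  by move=> ij jk kN; have [|[]] := HP i j k (N + 2); first lia.
have HC i j k : i < j -> j < k -> k < N + 2 -> (H i j == H j k) = C.
  by move=> ij jk kN; have [|[]] := HP i j k (N + 2); first lia.
have HE i j k l : [&& i < j, j < k, k < l & l < N + 3] -> (H i j == H k l) = E.
  by move=> /HP[].
have HF i j k l : [&& i < j, j < k, k < l & l < N + 3] -> (H i k == H j l) = F.
  by move=> /HP[].
have HG i j k l : [&& i < j, j < k, k < l & l < N + 3] -> (H i l == H j k) = G.
  by move=> /HP[].
(* The shift keeps the indices 1 to [N], so that 0 below and [N.+1] above remain available as common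
   reference points. *)
exists (g \o succn); split.
  case: gM => g1 g2; split=> [i j ij|i iN] /=; first by apply: g1; lia.
  by apply: g2; lia.
rewrite /comp -/(H _ _) {HP}.
have injB : ~~ B -> forall i j, i < N -> j < N -> H i.+1 N.+1 = H j.+1 N.+1 -> i = j.
  move=> nB i j iN jN /eqP; case: (ltngtP i j) => // ij.
    by rewrite HB ?(negPf nB) //; lia.
  by rewrite eq_sym HB ?(negPf nB) //; lia.
have injA : ~~ A -> forall i j, i < N -> j < N -> H 0 i.+1 = H 0 j.+1 -> i = j.
  move=> nA i j iN jN /eqP; case: (ltngtP i j) => // ij.
    by rewrite HA ?(negPf nA) //; lia.
  by rewrite eq_sym HA ?(negPf nA) //; lia.
case: (boolP A) => [At|nA]; case: (boolP B) => [Bt|nB].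
- constructor 1; exists (H 0 N.+1) => i j ij.
  have /eqP e1 : H i.+1 j.+1 == H i.+1 N.+1 by rewrite HA //; lia.
  have /eqP e2 : H 0 N.+1 == H i.+1 N.+1 by rewrite HB //; lia.
  by rewrite -[LHS]/(H i.+1 j.+1) e1 e2.
- constructor 2; exists (fun i => H i.+1 N.+1); split=> [i j|i j ij].
    by rewrite !inE; exact: injB.
  by apply/eqP; rewrite -[_ == _]/(H i.+1 j.+1 == H i.+1 N.+1) HA //; lia.
- constructor 3; exists (fun i => H 0 i.+1); split=> [i j|i j ij].
    by rewrite !inE; exact: injA.
  by apply/eqP; rewrite eq_sym -[_ == _]/(H 0 j.+1 == H i.+1 j.+1) HB //; lia.
constructor 4.
(* Any coincidence between two different edges persists when one endpoint is
   moved up to [N.+1], and comparing the two coincidences contradicts [~~ A]. *)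
suff main i j k l : i < j < N -> k < l < N -> i <= k ->
    H i.+1 j.+1 = H k.+1 l.+1 -> i = k /\ j = l.
  move=> i j k l ij kl e; case: (leqP i k) => ik; first exact: main.
  by have [] := main k l i j kl ij (ltnW ik) (esym e) => -> ->.
have noA x y : x < y -> y < N.+1 -> H x y = H x N.+1 -> False.
  by move=> xy yN /eqP; rewrite HA ?(negPf nA) //; lia.
move=> /andP[ij jN] /andP[kl lN]; rewrite leq_eqVlt => /predU1P[eik|ik] e.
  subst k; split=> //; move/eqP: e; case: (ltngtP j l) => // jl.
    by rewrite HA ?(negPf nA) //; lia.
  by rewrite eq_sym HA ?(negPf nA) //; lia.
exfalso; case: (eqVneq j l) => [ejl|jl].
  by move/eqP: e; rewrite ejl HB ?(negPf nB) //; lia.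
case: (ltngtP j k) => jk.
- have Et : E by rewrite -(HE i.+1 j.+1 k.+1 l.+1) ?e ?eqxx //; lia.
  apply: (@noA k.+1 l.+1); [lia | lia | rewrite -e].
  by apply/eqP; rewrite HE //; lia.
- case: (ltngtP j l) jl => // jl _.
    have Ft : F by rewrite -(HF i.+1 k.+1 j.+1 l.+1) ?e ?eqxx //; lia.
    apply: (@noA k.+1 l.+1); [lia | lia | rewrite -e].
    by apply/eqP; rewrite HF //; lia.
  have Gt : G by rewrite -(HG i.+1 k.+1 l.+1 j.+1) ?e ?eqxx //; lia.
  apply: (@noA i.+1 j.+1); [lia | lia | rewrite e].
  by apply/eqP; rewrite eq_sym HG //; lia.
have Ct : C by rewrite -(HC i.+1 j.+1 l.+1) ?e ?jk ?eqxx //; lia.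
apply: (@noA k.+1 l.+1); [lia | lia | rewrite -e jk].
by apply/eqP; rewrite HC //; lia.
Qed.

(** * Colours on lists of vertices, and realising every number of colours *)

(** Multiplicities are kept: [uniq] of this list expresses that the vertices are rainbow coloured,
    and the size of its [undup] counts the colours. *)
Fixpoint pair_colours (V : Type) (d : V -> V -> nat) (s : seq V) : seq nat :=
  if s is x :: s' then map (d x) s' ++ pair_colours d s' else [::].

(** The order is reversed so that adding the vertex [z k] is a cons, in step with the recursion of
    [pair_colours]. *)
Fixpoint prefix_rev (V : Type) (z : nat -> V) (k : nat) : seq V :=
  if k is k'.+1 then z k' :: prefix_rev z k' else [::].

(** The three alternatives of the theorem, with duplicate-free lists in place of sets and a function
    of two vertices in place of a colouring of edges. Diagonal values [d x x] never enter. *)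
Definition conclusion (V : eqType) (d : V -> V -> nat) (n : nat) :=
  [\/ forall m, 1 <= m <= n ->
        exists s, uniq s /\ size (undup (pair_colours d s)) = m,
      exists s, [/\ uniq s, size s = n & uniq (pair_colours d s)]
    | exists w s c, [/\ uniq (w :: s), (size s).+1 = n,
        {in pair_colours d s, forall k, k = c},
        uniq (map (d w) s) & c \notin map (d w) s]].

Lemma size_prefix_rev (V : Type) (z : nat -> V) k : size (prefix_rev z k) = k.
Proof. by elim: k => //= k ->. Qed.

Lemma mem_prefix_rev (V : eqType) (z : nat -> V) k x :
  reflect (exists2 i, i < k & x = z i) (x \in prefix_rev z k).
Proof.
elim: k => [|k IH] /=; first by constructor=> -[].
rewrite inE; apply: (iffP predU1P) => [[->|/IH[i ik ->]]|[i]].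
- by exists k.
- by exists i => //; exact: ltnW.
rewrite ltnS leq_eqVlt => /predU1P[->|ik] e; first by left.
by right; apply/IH; exists i.
Qed.

Lemma prefix_rev_uniq (V : eqType) (z : nat -> V) k :
  {in gtn k &, injective z} -> uniq (prefix_rev z k).
Proof.
elim: k => //= k IH zinj; apply/andP; split.
  apply/mem_prefix_rev=> -[i ik /zinj]; rewrite !inE ltnS leqnn leqW //.
  by move=> /(_ isT isT) e; rewrite e ltnn in ik.
by apply: IH => i j; rewrite !inE => ik jk; apply: zinj; rewrite inE leqW.
Qed.

Section Colouring.

Variables (V : eqType) (d : V -> V -> nat).
Hypothesis dC : forall x y, d x y = d y x.
Implicit Types z : nat -> V.

Lemma mem_pair_colours z k c :
  reflect (exists i j, i < j < k /\ c = d (z i) (z j))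
    (c \in pair_colours d (prefix_rev z k)).
Proof.
elim: k c => [|k IH] c /=; first by constructor=> -[i [j []]]; rewrite ltn0 andbF.
rewrite mem_cat; apply: (iffP orP) => [[/mapP[x /mem_prefix_rev[i ik ->] ->]|/IH]|].
- by exists i, k; rewrite ik ltnSn dC.
- by move=> [i [j [/andP[ij jk] ->]]]; exists i, j; rewrite ij leqW.
move=> [i [j [/andP[ij]]]]; rewrite ltnS leq_eqVlt => /predU1P[jk|jk] ->.
  by left; subst j; rewrite dC map_f //; apply/mem_prefix_rev; exists i.
by right; apply/IH; exists i, j; rewrite ij.
Qed.

Lemma pair_colours_uniq z k :
  (forall i j i' j', i < j < k -> i' < j' < k ->
    d (z i) (z j) = d (z i') (z j') -> i = i' /\ j = j') ->
  uniq (pair_colours d (prefix_rev z k)).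
Proof.
elim: k => //= k IH zinj; rewrite cat_uniq; apply/and3P; split.
- rewrite map_inj_in_uniq.
    apply: prefix_rev_uniq => i j; rewrite !inE => ik jk e.
    by have [] := zinj i k j k; rewrite ?ik ?jk ?ltnSn //= e.
  move=> _ _ /mem_prefix_rev[i ik ->] /mem_prefix_rev[j jk ->].
  rewrite !(dC (z k)) => /(zinj _ _ _ _ _ _)[]; rewrite ?ik ?jk ?ltnSn //.
  by move=> ->.
- apply/hasPn => _ /mem_pair_colours[i [j [/andP[ij jk] ->]]].
  apply/mapP=> -[_ /mem_prefix_rev[l lk ->]]; rewrite (dC (z k)) => /zinj[||_ e].
  + by lia.
  + by lia.
  by lia.
by apply: IH => i j i' j' ij ij'; apply: zinj; lia.
Qed.

(* Discrete intermediate value property: each new vertex brings at most one new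
   colour, so every smaller number of colours occurs on some prefix. *)
Lemma all_counts n z K (L : seq nat) :
  {in gtn K &, injective z} ->
  (forall k, k < K -> exists u, forall i, i < k -> d (z i) (z k) = u \/
     exists i' j', i' < j' < k /\ d (z i) (z k) = d (z i') (z j')) ->
  uniq L -> n <= size L ->
  {in L, forall c, exists i j, i < j < K /\ c = d (z i) (z j)} ->
  conclusion d n.
Proof.
move=> zinj new uL sL Lin; constructor 1 => m /andP[_ mn].
pose N k := size (undup (pair_colours d (prefix_rev z k))).
have NK : n <= N K.
  apply: leq_trans sL _; apply: uniq_leq_size => // c /Lin cP.
  by rewrite mem_undup; apply/mem_pair_colours.
have Nstep k : k < K -> N k.+1 <= (N k).+1.
  move=> /new[u uP].
  rewrite -/(size (u :: undup (pair_colours d (prefix_rev z k)))).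
  apply: uniq_leq_size; first exact: undup_uniq.
  move=> c; rewrite mem_undup inE [c \in undup _]mem_undup /= mem_cat.
  case/orP=> [/mapP[_ /mem_prefix_rev[i ik ->] ->]|->]; last by rewrite orbT.
  rewrite dC; case: (uP i ik) => [->|]; first by rewrite eqxx.
  by move=> h; apply/orP; right; apply/mem_pair_colours.
suff [k kK <-] : exists2 k, k <= K & N k = m.
  exists (prefix_rev z k); split=> //; apply: prefix_rev_uniq => i j.
  by rewrite !inE => ik jk; apply: zinj; rewrite inE; lia.
(* The shortest prefix with at least [m] colours has exactly [m]: the prefix before it has fewer,
   and one vertex adds at most one. *)
have [k kP kmin] := ex_minnP (ex_intro (fun k => m <= N k) K (leq_trans mn NK)).
have kK := kmin K (leq_trans mn NK); exists k => //.
case: k kP kmin kK => [|k] kP kmin kK; first by move: kP; rewrite /N /=; lia.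
have := Nstep k kK; have := kmin k; lia.
Qed.

End Colouring.

(** * A vertex that sees many colours *)

Lemma star_conclusion n : exists S, forall (V : eqType) (d : V -> V -> nat),
  (forall x y, d x y = d y x) -> forall (w : V) (v : nat -> V),
  (forall i, i < S -> w <> v i) ->
  {in gtn S &, injective (fun i => d w (v i))} -> conclusion d n.
Proof.
case: n => [|n]; first by exists 0 => V d _ _ _ _ _; constructor 2; exists [::].
(* Among [n.+2] leaves, [n.+1] occur as smaller endpoints and [n.+1] as larger ones, which gives the
   [n.+1] colours needed. A star needs only [n] leaves, so one may be dropped. *)
have [M HM] := erdos_rado n.+2; exists M => V d dC w v wv dinj.
have [g [ge can]] := HM (fun i j => d (v i) (v j)).
pose x i := v (g i).
have xw i : i < n.+2 -> w <> x i by move=> /(proj2 ge)/wv.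
have dxinj : {in gtn n.+2 &, injective (fun i => d w (x i))}.
  move=> i j; rewrite !inE => iN jN /dinj; rewrite !inE => e.
  by apply: (extraction_inj ge iN jN); apply: e; exact: (proj2 ge).
have xinj : {in gtn n.+2 &, injective x}.
  by move=> i j iN jN e; apply: dxinj => //=; rewrite e.
case: can => [[c cP]|[f [finj fP]]|[f [finj fP]]|rb].
(* The edges at [w] have distinct colours, so at most one leaf [b] is joined to [w] in the common
   colour [c]; [bump b] skips it. If there is none, 0 is skipped instead. *)
- have [b bP] : exists b, forall i, i < n.+2 -> d w (x i) = c -> i = b.
    have [[b [bN bc]]|nb] := pselect (exists b, b < n.+2 /\ d w (x b) = c).
      by exists b => i iN ic; apply: dxinj; rewrite ?inE // ic.
    by exists 0 => i iN ic; case: nb; exists i.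
  pose y i := x (bump b i).
  have yN i : i < n -> bump b i < n.+2 by rewrite /bump; lia.
  have yinj : {in gtn n &, injective y}.
    move=> i j iN jN /xinj e; apply: (can_inj (bumpK b)); apply: e; exact: yN.
  constructor 3; exists w, (prefix_rev y n), c; split=> /=.
  + rewrite prefix_rev_uniq // andbT; apply/mem_prefix_rev => -[i iN].
    exact: xw (yN _ iN).
  + by rewrite size_prefix_rev.
  + move=> k /(mem_pair_colours dC)[i [j [ij ->]]]; apply: cP.
    by rewrite /bump; lia.
  + rewrite map_inj_in_uniq ?prefix_rev_uniq //.
    move=> _ _ /mem_prefix_rev[i iN ->] /mem_prefix_rev[j jN ->] /dxinj e.
    by rewrite /y e // inE yN.
  apply/mapP => -[_ /mem_prefix_rev[i iN ->]] /esym /(bP _ (yN _ iN)) e.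
  by have := neq_bump b i; rewrite e eqxx.
- apply: (@all_counts _ _ dC n.+1 x n.+2 (map f (iota 0 n.+1))) => //.
  (* The edge from leaf [i] to leaf [k] has colour [f i], which for [i < k.-1] already occurs
     between the leaves [i] and [k.-1]. Only [f k.-1] can be new. *)
  + move=> k kN; exists (f k.-1) => i ik.
    rewrite fP ?ik //; have [|e] := ltnP i k.-1; last by left; congr f; lia.
    by move=> ik1; right; exists i, k.-1; rewrite fP; [split=> //; lia|lia].
  + rewrite map_inj_in_uniq ?iota_uniq // => i j; rewrite !mem_iota => ? ?.
    by apply: finj; rewrite inE; lia.
  + by rewrite size_map size_iota.
  move=> c /mapP[i]; rewrite mem_iota => iN ->; exists i, n.+1.
  by rewrite fP; [split=> //; lia|lia].
- apply: (@all_counts _ _ dC n.+1 x n.+2 (map f (iota 1 n.+1))) => //.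
  + by move=> k kN; exists (f k) => i ik; left; rewrite fP ?ik.
  + rewrite map_inj_in_uniq ?iota_uniq // => i j; rewrite !mem_iota => ? ?.
    by apply: finj; rewrite inE; lia.
  + by rewrite size_map size_iota.
  move=> c /mapP[i]; rewrite mem_iota => iN ->; exists 0, i.
  by rewrite fP; [split=> //; lia|lia].
constructor 2; exists (prefix_rev x n.+1); split.
- by apply: prefix_rev_uniq => i j; rewrite !inE => ? ?; apply: xinj; rewrite inE leqW.
- exact: size_prefix_rev.
by apply: pair_colours_uniq => // i j i' j' ij ij'; apply: rb; lia.
Qed.

(** * A large matching with distinct colours *)

(** In each nonconstant canonical case some vertex has distinctly coloured edges to many others, so
    the star case applies. The two sequences may coincide, which lets one lemma treat all four
    colourings given by a matching. *)
Lemma cross_constant n N : exists M, forall (V : eqType) (d : V -> V -> nat),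
  (forall x y, d x y = d y x) -> forall x y : nat -> V,
  (forall i j, i < j < M -> x i <> y j) ->
  conclusion d n \/ exists g c, extraction M N g /\
    forall i j, i < j < N -> d (x (g i)) (y (g j)) = c.
Proof.
have [S HS] := star_conclusion n.
(* Besides the [N] indices of the constant case, there is room for a centre and [S] leaves: the last
   [y] with leaves among the [x], or the first [x] with leaves among the [y]. *)
have [M HM] := erdos_rado (N + S.+1).
exists M => V d dC x y xy.
have [g [ge can]] := HM (fun i j => d (x i) (y j)).
have gxy i j : i < j < N + S.+1 -> x (g i) <> y (g j).
  by case: ge => g1 g2 ij; apply: xy; rewrite g1 //= g2; lia.
case: can => [[c cP]|[f [finj fP]]|[f [finj fP]]|rb].
- right; exists g, c; split; last by move=> i j ij; apply: cP; lia.
  by case: ge => g1 g2; split=> *; [apply: g1|apply: g2]; lia.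
- left; apply: (HS V d dC (y (g (N + S))) (x \o g)) => /= [i iS /esym|i j].
    by apply: gxy; lia.
  rewrite !inE => iS jS; rewrite !(dC (y _)) !fP; try lia.
  by apply: finj; rewrite inE; lia.
- left; apply: (HS V d dC (x (g 0)) (y \o g \o succn)) => /= [i iS|i j].
    by apply: gxy; lia.
  rewrite !inE => iS jS; rewrite !fP; try lia.
  by move=> /finj e; apply: succn_inj; apply: e; rewrite inE; lia.
left; apply: (HS V d dC (x (g 0)) (y \o g \o succn)) => /= [i iS|i j].
  by apply: gxy; lia.
by rewrite !inE => iS jS /rb[]; try lia; move=> _ [].
Qed.

Definition matching (V : eqType) (d : V -> V -> nat) M (v w : nat -> V) :=
  [/\ {in gtn M &, injective v}, {in gtn M &, injective w},
      forall i j, i < M -> j < M -> v i <> w j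
    & {in gtn M &, injective (fun i => d (v i) (w i))}].

Lemma matching_comp (V : eqType) (d : V -> V -> nat) M N v w g :
  matching d M v w -> extraction M N g -> matching d N (v \o g) (w \o g).
Proof.
move=> [vinj winj vw cinj] ge; have g2 := proj2 ge.
split=> [i j|i j|i j iN jN|i j] /=; last 1 first.
- rewrite !inE => iN jN /cinj e; apply: (extraction_inj ge iN jN).
  by apply: e; rewrite inE g2.
- rewrite !inE => iN jN /vinj e; apply: (extraction_inj ge iN jN).
  by apply: e; rewrite inE g2.
- rewrite !inE => iN jN /winj e; apply: (extraction_inj ge iN jN).
  by apply: e; rewrite inE g2.
by apply: vw; exact: g2.
Qed.

(* The vertices are taken in the order v0, v1, w2, w3, v4, w4, v5, w5, ...; the
   first five create the cross colours one at a time, and then each w_j creates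
   only the colour of v_j w_j. *)
Lemma constant_matching_conclusion n (V : eqType) (d : V -> V -> nat)
    (dC : forall x y, d x y = d y x) (v w : nat -> V) a b p q :
  matching d (n + 4) v w ->
  (forall i j, i < j < n + 4 ->
    [/\ d (v i) (v j) = a, d (w i) (w j) = b,
        d (v i) (w j) = p & d (w i) (v j) = q]) ->
  conclusion d n.
Proof.
move=> [vinj winj vw cinj] cP.
have ca i j : i < j < n + 4 -> d (v i) (v j) = a by case/cP.
have cb i j : i < j < n + 4 -> d (w i) (w j) = b by case/cP.
have cp i j : i < j < n + 4 -> d (v i) (w j) = p by case/cP.
have cq i j : i < j < n + 4 -> d (w i) (v j) = q by case/cP.
(* The vertex in position [k] is a [w] when [side k] holds and a [v] otherwise, with index [idx k].
   From position 4 on, positions [2 * j - 4] and [2 * j - 3] hold [v j] and [w j]. *)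
pose side k := if k < 4 then 1 < k else odd k.
pose idx k := if k < 4 then k else k./2 + 2.
pose z k := if side k then w (idx k) else v (idx k).
have idxN k : k < n.*2 + 4 -> idx k < n + 4 by rewrite /idx; case: ifP; lia.
(* Indices increase along the order except from [v j] to [w j], so every pair but these has one of
   the colours [a], [b], [p], [q]. *)
have lt i k : i < k -> idx i < idx k \/
   [/\ idx i = idx k, side i = false, side k = true & 4 < k].
  rewrite /idx /side => ik; case: (ltnP i 4) => i4; case: (ltnP k 4) => k4.
  - by left.
  - by left; lia.
  - by lia.
  have [|] := ltnP i./2 k./2; first by left; lia.
  by right; split; lia.
(* Positions 4 to [2 * n + 3] contain [n] whole matching edges, whose distinct colours bound the
   final count from below. *)
apply: (@all_counts _ _ dC n z (n.*2 + 4) (mkseq (fun i => d (v (i + 4)) (w (i + 4))) n)).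
- move=> i j; rewrite !inE => iK jK; have iN := idxN _ iK; have jN := idxN _ jK.
  have idx_eq : side i = side j -> idx i = idx j -> i = j.
    case: (ltngtP i j) => // /lt[].
    + by move=> ? ? ?; lia.
    + by move=> [_ -> ->].
    + by move=> ? ? ?; lia.
    + by move=> [_ -> ->].
  rewrite /z; case si: (side i); case sj: (side j) => e.
  + by apply: idx_eq; rewrite ?si ?sj //; apply: winj.
  + by case: (vw _ _ jN iN (esym e)).
  + by case: (vw _ _ iN jN e).
  + by apply: idx_eq; rewrite ?si ?sj //; apply: vinj.
- move=> k kK.
  (* The list gives the possibly new colour at each of the first five positions; its entry for
     position 0 is arbitrary, as no vertex precedes. Afterwards the default applies, the colour of
     the matching edge of index [idx k]. *)
  exists (nth (d (v (idx k)) (w (idx k))) [:: a; a; p; b; q] k) => i ik.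
  have kN := idxN _ kK.
  case: (ltnP k 5) => k5.
    move: k i k5 ik kK {kN} => [|[|[|[|[|//]]]]] [|[|[|[|//]]]] // _ _ kK;
      rewrite /z /side /idx /=.
    + by left; rewrite ?ca ?cb ?cp ?cq //; lia.
    + by left; rewrite ?ca ?cb ?cp ?cq //; lia.
    + by left; rewrite ?ca ?cb ?cp ?cq //; lia.
    + by right; exists 0, 2; split=> //; rewrite /= ?ca ?cb ?cp ?cq //; lia.
    + by right; exists 0, 2; split=> //; rewrite /= ?ca ?cb ?cp ?cq //; lia.
    + by left; rewrite ?ca ?cb ?cp ?cq //; lia.
    + by right; exists 0, 1; split=> //; rewrite /= ?ca ?cb ?cp ?cq //; lia.
    + by right; exists 0, 1; split=> //; rewrite /= ?ca ?cb ?cp ?cq //; lia.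
    + by left; rewrite ?ca ?cb ?cp ?cq //; lia.
    + by left; rewrite ?ca ?cb ?cp ?cq //; lia.
  rewrite nth_default //; case: (lt i k ik) => [ltik|[e si sk _]]; last first.
    by left; rewrite /z si sk e.
  right.
  (* All four cross colours occur among the first five positions: [b] at (2, 3), [q] at (2, 4), [p]
     at (0, 2) and [a] at (0, 1). *)
  have ltN : idx i < idx k < n + 4 by rewrite ltik.
  rewrite {1 2}/z; case: (side i); case: (side k); rewrite ?ca ?cb ?cp ?cq //.
  + by exists 2, 3; split; [lia|rewrite /z /side /idx /= ?ca ?cb ?cp ?cq //; lia].
  + by exists 2, 4; split; [lia|rewrite /z /side /idx /= ?ca ?cb ?cp ?cq //; lia].
  + by exists 0, 2; split; [lia|rewrite /z /side /idx /= ?ca ?cb ?cp ?cq //; lia].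
  + by exists 0, 1; split; [lia|rewrite /z /side /idx /= ?ca ?cb ?cp ?cq //; lia].
- rewrite map_inj_in_uniq ?iota_uniq // => i j; rewrite !mem_iota => iN jN /cinj.
  by rewrite !inE => e; apply: (@addIn 4); apply: e; lia.
- by rewrite size_mkseq.
move=> c /mapP[i]; rewrite mem_iota => /andP[_ iN] ->.
exists (i.*2 + 4), (i.*2 + 5); split; first by lia.
have e1 : side (i.*2 + 4) = false by rewrite /side; case: ifP; lia.
have e2 : side (i.*2 + 5) = true by rewrite /side; case: ifP; lia.
have e3 : idx (i.*2 + 4) = i + 4 by rewrite /idx; case: ifP; lia.
have e4 : idx (i.*2 + 5) = i + 4 by rewrite /idx; case: ifP; lia.
by rewrite /z e1 e2 e3 e4.
Qed.

Lemma matching_conclusion n : exists M, forall (V : eqType) (d : V -> V -> nat),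
  (forall x y, d x y = d y x) -> forall v w : nat -> V,
  matching d M v w -> conclusion d n.
Proof.
(* Four successive refinements make the four colourings constant; their sizes are fixed from the
   last one back to the first. *)
have [M1 H1] := cross_constant n (n + 4).
have [M2 H2] := cross_constant n M1.
have [M3 H3] := cross_constant n M2.
have [M4 H4] := cross_constant n M3.
exists M4 => V d dC v w m4.
have ltneq N (f : nat -> V) : {in gtn N &, injective f} ->
    forall i j, i < j < N -> f i <> f j.
  move=> finj i j ij /finj e; suff : i = j by lia.
  by apply: e; rewrite inE; lia.
have [//|[g4 [a [ge4 aP]]]] : conclusion d n \/ exists g c, extraction M4 M3 g /\
    forall i j, i < j < M3 -> d (v (g i)) (v (g j)) = c.
  by apply: H4 => //; case: m4 => vinj _ _ _; exact: ltneq.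
have m3 := matching_comp m4 ge4.
have [//|[g3 [b [ge3 bP]]]] : conclusion d n \/ exists g c, extraction M3 M2 g /\
    forall i j, i < j < M2 -> d ((w \o g4) (g i)) ((w \o g4) (g j)) = c.
  by apply: (H3 _ _ dC); case: m3 => _ winj _ _; exact: ltneq.
have m2 := matching_comp m3 ge3.
have [//|[g2 [p [ge2 pP]]]] : conclusion d n \/ exists g c, extraction M2 M1 g /\
    forall i j, i < j < M1 -> d ((v \o g4 \o g3) (g i)) ((w \o g4 \o g3) (g j)) = c.
  by apply: (H2 _ _ dC) => i j ij; case: m2 => _ _ vw _; apply: vw; lia.
have m1 := matching_comp m2 ge2.
have [//|[g1 [q [ge1 qP]]]] : conclusion d n \/ exists g c, extraction M1 (n + 4) g /\
    forall i j, i < j < n + 4 ->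
      d ((w \o g4 \o g3 \o g2) (g i)) ((v \o g4 \o g3 \o g2) (g j)) = c.
  apply: (H1 _ _ dC) => i j ij /esym.
  by case: m1 => _ _ vw _; apply: vw; lia.
have m0 := matching_comp m1 ge1.
(* Constancy obtained early survives later refinements, because these send increasing pairs of
   indices to increasing pairs. *)
have lift M N g i j : extraction M N g -> i < j < N -> g i < g j < M.
  by move=> [h1 h2] ij; rewrite h1 //= h2; lia.
apply: (constant_matching_conclusion dC m0 (a := a) (b := b) (p := p) (q := q)).
move=> i j l0; have l1 := lift _ _ _ _ _ ge1 l0; have l2 := lift _ _ _ _ _ ge2 l1.
have l3 := lift _ _ _ _ _ ge3 l2.
by split=> /=; [exact: aP | exact: bP | exact: pP | exact: qP].
Qed.

(** * Extracting a star or a matching from differently coloured edges *)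

(** Greedy choice: if an endpoint of the first edge lies on [S] of the remaining edges, these form a
    star. Otherwise fewer than [S] edges are discarded at each endpoint, and induction applies to
    the rest. *)
Lemma star_or_matching S M : exists K, forall (V : eqType) (d : V -> V -> nat),
  (forall x y, d x y = d y x) -> forall es : seq (V * V), K <= size es ->
  all (fun e => e.1 != e.2) es -> uniq [seq d e.1 e.2 | e <- es] ->
  (exists w l, [/\ size l = S, w \notin l & uniq (map (d w) l)]) \/
  exists ms, [/\ subseq ms es, size ms = M & uniq (map fst ms ++ map snd ms)].
Proof.
elim: M => [|M [K IH]].
  by exists 0 => V d _ es _ _ _; right; exists [::]; split=> //; exact: sub0seq.
exists (S + S + K).+1 => V d dC [//|[x y] es] /= szes /andP[xy nes] /andP[_ ues].
pose inc z := [pred e : V * V | (e.1 == z) || (e.2 == z)].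
have star z : S <= count (inc z) es ->
    exists w l, [/\ size l = S, w \notin l & uniq (map (d w) l)].
  move=> leS; pose oth (e : V * V) := if e.1 == z then e.2 else e.1.
  pose l := take S (filter (inc z) es).
  have lP : {in l, forall e, inc z e /\ e.1 != e.2}.
    move=> e /mem_take; rewrite mem_filter => /andP[-> /(allP nes)].
    by [].
  exists z, (map oth l); split.
  - by rewrite size_map size_takel // size_filter.
  - apply/mapP => -[e /lP[/=]]; rewrite /oth.
    case: (eqVneq e.1 z) => [-> _ /eqP ne e2|ne _ _ e1]; first exact: ne.
    by rewrite e1 eqxx in ne.
  rewrite -map_comp.
  have -> : map (d z \o oth) l = map (fun e => d e.1 e.2) l.
    apply/eq_in_map => e /lP[/= /orP[/eqP e1|/eqP e2] _]; rewrite /oth.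
      by rewrite e1 eqxx.
    by case: eqP => [->//|_]; rewrite e2 dC.
  apply: subseq_uniq ues; apply: map_subseq.
  exact: subseq_trans (take_subseq _ _) (filter_subseq _ _).
have [/star|ltx] := leqP S (count (inc x) es); first by left.
have [/star|lty] := leqP S (count (inc y) es); first by left.
pose P := predU (inc x) (inc y).
have szP : K <= size (filter (predC P) es).
  have := count_predC P es; have := count_predUI (inc x) (inc y) es.
  rewrite size_filter -/P; lia.
have sub : subseq (filter (predC P) es) es by exact: filter_subseq.
case: (IH V d dC _ szP) => [|||[ms [subms szms ums]]]; [| |by left|].
- by apply/allP => e /(mem_subseq sub)/(allP nes).
- exact: subseq_uniq (map_subseq _ sub) ues.
right; exists ((x, y) :: ms); split.
- by rewrite eqxx; exact: subseq_trans subms sub.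
- by rewrite /= szms.
have msP e : e \in ms -> [&& e.1 != x, e.2 != x, e.1 != y & e.2 != y].
  move=> /(mem_subseq subms); rewrite mem_filter /= => /andP[].
  by rewrite !negb_or -!andbA.
rewrite /= (perm_uniq (permEl (perm_catCA _ [:: y] _))) /= ums andbT.
rewrite mem_cat inE (negPf xy) /= -mem_cat mem_cat !negb_or -andbA.
have nin z f : (forall e, e \in ms -> f e != z) -> z \notin map f ms.
  by move=> fP; apply/mapP => -[e /fP] /eqP ne /esym.
by rewrite !mem_cat !negb_or !nin // => e /msP /and4P[].
Qed.

Lemma many_colours_conclusion n : exists K, forall (V : eqType) (d : V -> V -> nat),
  (forall x y, d x y = d y x) -> forall es : seq (V * V), K <= size es ->
  all (fun e => e.1 != e.2) es -> uniq [seq d e.1 e.2 | e <- es] ->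
  conclusion d n.
Proof.
have [S HS] := star_conclusion n; have [M HM] := matching_conclusion n.
(* One edge beyond [M] makes the matching nonempty, so that its head can supply default values for
   [nth]. *)
have [K HK] := star_or_matching S M.+1; exists K => V d dC es Kes nes ues.
case: (HK V d dC es Kes nes ues) => [[w [l [szl wl ul]]]|[ms [subms szms ums]]].
  apply: (HS V d dC w (nth w l)) => [i iS e|i j].
    by case/negP: wl; rewrite e mem_nth ?szl.
  rewrite !inE -szl => iS jS; rewrite -!(nth_map w 0) // => /eqP.
  by rewrite nth_uniq ?size_map // => /eqP.
case: ms szms subms ums => // e0 ms szms subms ums.
move: ums; set s := e0 :: ms; rewrite cat_uniq => /and3P[u1 /hasPn dis u2].
have szs : M < size s by rewrite szms.
have lts i : i < M -> i < size s by move=> iM; exact: ltn_trans iM szs.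
apply: (HM V d dC (nth e0.1 (map fst s)) (nth e0.2 (map snd s))); split=> [i j|i j|i j|i j].
- rewrite !inE => /lts iM /lts jM /eqP.
  by rewrite nth_uniq ?size_map // => /eqP.
- rewrite !inE => /lts iM /lts jM /eqP.
  by rewrite nth_uniq ?size_map // => /eqP.
- move=> /lts iM /lts jM e.
  have /dis/negP[] : nth e0.2 (map snd s) j \in map snd s by rewrite mem_nth ?size_map.
  by rewrite -e; apply: mem_nth; rewrite size_map.
rewrite !inE => /lts iM /lts jM; rewrite !(nth_map e0) //.
have us : uniq [seq d e.1 e.2 | e <- s] := subseq_uniq (map_subseq _ subms) ues.
rewrite -!(nth_map e0 0 (fun e => d e.1 e.2)) // => /eqP.
by rewrite nth_uniq ?size_map // => /eqP.
Qed.

(** * From lists of vertices back to sets and unordered edges *)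

Lemma uniq_map_inj_in (S T : eqType) (f : S -> T) (s : seq S) :
  uniq (map f s) -> {in s &, injective f}.
Proof.
elim: s => //= a s IH /andP[fa us] x y; rewrite !inE.
move=> /predU1P[->|xs] /predU1P[->|ys] // e.
- by rewrite e map_f in fa.
- by rewrite -e map_f in fa.
exact: IH.
Qed.

Local Open Scope classical_set_scope.
Local Open Scope card_scope.

Lemma card_set_seq (T : eqType) (s : seq T) : uniq s -> [set` s] #= `I_(size s).
Proof.
case: s => [_|x s us].
  suff -> : [set` [::]] = set0 :> set T by rewrite II0.
  by apply/seteqP; split.
rewrite (_ : [set` _] = nth x (x :: s) @` `I_(size (x :: s))).
  apply: inj_card_eq => i j; rewrite !inE /= => iN jN /eqP.
  by rewrite nth_uniq // => /eqP.
apply/seteqP; split=> [y ys|_ [i iN <-]]; last exact: mem_nth.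
by exists (index y (x :: s)); [exact: (etrans (index_mem _ _) ys) | exact: nth_index].
Qed.

Lemma card_set2 (T : Type) (x y : T) : x <> y -> [set x; y] #= `I_2.
Proof.
elim/Peq: T => T in x y * => /eqP xy.
have -> : [set x; y] = [set` [:: x; y]].
  apply/seteqP; split=> z /=; rewrite !inE; first by case=> ->; rewrite eqxx ?orbT.
  by case/orP=> /eqP->; [left|right].
by apply: (card_set_seq (s := [:: x; y])); rewrite /= inE xy.
Qed.

Section Transfer.

Variables (V : eqType) (D : edge V -> nat).

Definition edge_of (x y : V) (xy : x <> y) : edge V :=
  exist _ [set x; y] (card_set2 xy).

(** The value 0 on the diagonal makes this a total symmetric function, as the list form requires. *)
Definition colour (x y : V) : nat :=
  if pselect (x <> y) is left xy then D (edge_of xy) else 0.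

Lemma edgeP (e : edge V) : exists x y, x <> y /\ sval e = [set x; y].
Proof.
case: e => e /= /card_set_bijP[f [fS finj fsurj]].
have [x ex fx] := fsurj 0 isT; have [y ey fy] := fsurj 1 isT.
exists x, y; split; first by move=> xy; rewrite xy fy in fx.
apply/seteqP; split=> [z ez|z [->|->]] //=.
have := fS z ez; case fz: (f z) => [|[|//]] _; [left|right].
  by apply: finj; rewrite ?inE // fz.
by apply: finj; rewrite ?inE // fz.
Qed.

Lemma edge_inj (e f : edge V) : sval e = sval f -> e = f.
Proof.
case: e f => [e pe] [f pf] /= ef; subst f.
by rewrite (bool_irrelevance pe pf).
Qed.

Lemma colourE (e : edge V) x y :
  x <> y -> sval e = [set x; y] -> D e = colour x y.
Proof.
move=> xy exy; rewrite /colour; case: pselect => // xy'.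
by congr D; apply: edge_inj.
Qed.

Lemma colourC x y : colour x y = colour y x.
Proof.
have [->//|/eqP xy] := eqVneq x y.
rewrite -(@colourE (edge_of xy) x y) //; apply: colourE; first exact: nesym.
by rewrite /= setUC.
Qed.

Lemma pair_coloursP s c : uniq s ->
  reflect (exists x y, [/\ x \in s, y \in s, x <> y & c = colour x y])
    (c \in pair_colours colour s).
Proof.
elim: s c => [|a s IH] c /=; first by constructor=> -[x [y []]].
move=> /andP[as_ us]; rewrite mem_cat.
apply: (iffP orP) => [[/mapP[y ys ->]|/(IH _ us)[x [y [xs ys xy ->]]]]|].
- exists a, y; rewrite !inE eqxx ys orbT; split=> // e.
  by rewrite e ys in as_.
- by exists x, y; rewrite !inE xs ys !orbT.
move=> [x [y []]]; rewrite !inE => /predU1P[->|xs] /predU1P[->|ys] // xy ->.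
- by left; exact: map_f.
- by left; rewrite colourC; exact: map_f.
by right; apply/(IH _ us); exists x, y.
Qed.

Lemma colours_seq s : uniq s ->
  colours D [set` s] = [set` pair_colours colour s].
Proof.
move=> us; apply/seteqP; split=> [_ [e es <-]|c /= /(pair_coloursP _ us)].
  have [x [y [xy exy]]] := edgeP e; rewrite (colourE xy exy) /=.
  apply/(pair_coloursP _ us); exists x, y; split=> //; apply: es; rewrite exy /=.
    by left.
  by right.
move=> [x [y [xs ys xy ->]]]; exists (edge_of xy); last exact: colourE.
by move=> z [->|->].
Qed.

(** Induction on the list: two pairs through the head are separated by the first block of colours, a
    pair through the head and one in the tail by the disjointness of the two blocks. *)
Lemma pair_colours_inj s x y x' y' : uniq (pair_colours colour s) ->
  x \in s -> y \in s -> x' \in s -> y' \in s -> x <> y -> x' <> y' ->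
  colour x y = colour x' y' -> [set x; y] = [set x'; y'].
Proof.
move=> upc xs ys xs' ys' xy xy' exy.
elim: s upc xs ys xs' ys' => [//|a s IH] /=; rewrite cat_uniq.
move=> /and3P[u1 /hasPn dis /IH{}IH] xs ys xs' ys'.
have dec u v : u \in a :: s -> v \in a :: s -> u <> v -> (u \in s /\ v \in s) \/
    exists2 b, b \in s & [set u; v] = [set a; b] /\ colour u v = colour a b.
  rewrite !inE => /predU1P[->|us] /predU1P[->|vs] // _.
  - by right; exists v.
  - by right; exists u => //; rewrite setUC colourC.
  by left.
have inpc u v : u \in s -> v \in s -> u <> v -> colour u v \in pair_colours colour s.
  elim: s {IH dis u1 xs ys xs' ys' dec} => [//|b s IHs] /=.
  rewrite !inE mem_cat => /predU1P[->|us] /predU1P[->|vs] // uv.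
  - by rewrite map_f.
  - by rewrite colourC map_f.
  by rewrite IHs ?orbT.
case: (dec x y xs ys xy) => [[xs1 ys1]|[b bs [-> cb]]];
  case: (dec x' y' xs' ys' xy') => [[xs2 ys2]|[b' bs' [-> cb']]].
- exact: IH.
- have /dis/negP[] := inpc x y xs1 ys1 xy.
  by rewrite exy cb'; exact: map_f.
- have /dis/negP[] := inpc x' y' xs2 ys2 xy'.
  by rewrite -exy cb; exact: map_f.
rewrite exy cb' in cb; congr [set a; _].
exact: (uniq_map_inj_in u1).
Qed.

Lemma rainbow_seq s : uniq (pair_colours colour s) -> rainbow D [set` s].
Proof.
move=> upc e f es fs ef Def; apply: ef; apply: edge_inj.
have [x [y [xy exy]]] := edgeP e; have [x' [y' [xy' fxy]]] := edgeP f.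
rewrite exy fxy; apply: (pair_colours_inj upc) => //.
- by apply: es; rewrite exy; left.
- by apply: es; rewrite exy; right.
- by apply: fs; rewrite fxy; left.
- by apply: fs; rewrite fxy; right.
by rewrite -(colourE xy exy) -(colourE xy' fxy).
Qed.

Lemma star_seq w s c : uniq (w :: s) ->
  {in pair_colours colour s, forall k, k = c} ->
  uniq (map (colour w) s) -> c \notin map (colour w) s ->
  star D [set` w :: s].
Proof.
move=> /= /andP[ws us] sc uw cw; exists w; first by rewrite /= mem_head.
(* An edge at the centre is determined by its leaf, which reduces distinctness over edges to
   distinctness over leaves. *)
have centreP (e : edge V) : edges_within [set` w :: s] e -> sval e w ->
    exists2 y, y \in s & sval e = [set w; y] /\ D e = colour w y.
  move=> es; have [x [y [xy exy]]] := edgeP e; rewrite exy => wxy.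
  have [y' [wy' ey']] : exists y', w <> y' /\ sval e = [set w; y'].
    case: wxy => ->; first by exists y.
    by exists x; rewrite exy setUC; split=> //; exact: nesym.
  exists y'; last by rewrite -exy (colourE wy' ey').
  have : y' \in w :: s by apply: es; rewrite ey'; right.
  by rewrite inE => /predU1P[/esym|].
exists c; split=> [e es|e f es fs ew fw ef|e es /(centreP e es)[y ys [_ ->]] yc].
- apply: sc; apply/(pair_coloursP _ us).
  have [x [y [xy exy]]] := edgeP e; exists x, y; split=> //; last exact: colourE.
    have [] := es x; first by rewrite exy; left.
    by rewrite /= inE => /predU1P[->|].
  have [] := es y; first by rewrite exy; right.
  by rewrite /= inE => /predU1P[->|].
- have [y ys [ey ->]] := centreP e es ew; have [y' ys' [fy ->]] := centreP f fs fw.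
  move=> dyy; apply: ef; apply: edge_inj; rewrite ey fy; congr [set w; _].
  exact: (uniq_map_inj_in uw).
by rewrite -yc map_f in cw.
Qed.

End Transfer.

Theorem mainTheorem6 (n : nat) :
  exists k1 : nat,
  forall (V : Type), countable [set: V] ->
  forall D : edge V -> nat,
  `I_k1 #<= colours D [set: V] ->
  [\/ forall m : nat, 1 <= m <= n -> exists X : set V, colours D X #= `I_m,
      exists X : set V, rainbow D X /\ X #= `I_n
    | exists X : set V, star D X /\ X #= `I_n].
Proof.
have [K HK] := many_colours_conclusion n; exists K => V _.
(* [Peq] equips [V] with classical decidable equality, and [f] injects [I_K] into the set of
   colours. *)
elim/Peq: V => V D /pcard_leP[f].
(* One edge is chosen for each colour [f i] with [i < K]; injectivity of [f] will make the colours
   distinct. *)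
have [es [nes ecol]] : exists es : seq (V * V), all (fun e => e.1 != e.2) es /\
    [seq colour D e.1 e.2 | e <- es] = map f (iota 0 K).
  have : {in iota 0 K, forall i, i < K} by move=> i; rewrite mem_iota.
  elim: (iota 0 K) => [|i l IH] lK; first by exists [::].
  have [|es [nes ecol]] := IH; first by move=> j jl; apply: lK; rewrite inE jl orbT.
  have [e _ eD] : colours D [set: V] (f i) by apply: funS; apply: lK; rewrite mem_head.
  have [x [y [xy exy]]] := edgeP e; exists ((x, y) :: es).
  by rewrite /= nes ecol -(colourE D xy exy) eD andbT; split=> //; apply/eqP.
have szes : size es = K by rewrite -(size_map (fun e => colour D e.1 e.2)) ecol size_map size_iota.
case: (HK V (colour D) (colourC D) es); rewrite ?szes ?ecol //.
- rewrite map_inj_in_uniq ?iota_uniq // => i j; rewrite !mem_iota => iK jK.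
  by apply: inj; rewrite inE.
- move=> Hm; constructor 1 => m /Hm[s [us sm]]; exists [set` s].
  rewrite colours_seq // (_ : [set` _] = [set` undup (pair_colours (colour D) s)]).
    by rewrite -sm; apply: card_set_seq; exact: undup_uniq.
  by apply/seteqP; split=> c /=; rewrite mem_undup.
- move=> [s [us sn upc]]; constructor 2; exists [set` s].
  by split; [exact: rainbow_seq | rewrite -sn; exact: card_set_seq].
move=> [w [s [c [us sn sc uw cw]]]]; constructor 3; exists [set` w :: s].
by split; [exact: (star_seq us sc) | rewrite -sn; exact: (card_set_seq us)].
Qed.
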